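(* For every negative integer $\alpha\in\mathbb{Z}^-=\{-1,-2,-3,\dots\}$, the sharp constants $\mathcal{A}^{\mathrm{disc}}_{\alpha,2}$ and $\mathcal{A}^{\mathrm{cont}}_{\alpha,2}$ are not equal: $$\mathcal{A}^{\mathrm{disc}}_{\alpha,2}\neq\mathcal{A}^{\mathrm{cont}}_{\alpha,2}.$$
   Context: $H^1_0(\mathbb{N})$ denotes the space of finitely supported real sequences $u=(u_n)_{n\ge0}$ with $u_0=0$. $\mathcal{A}^{\mathrm{disc}}_{\alpha,2}$ denotes the sharp (largest) constant such that $$\sum_{n=1}^\infty|u_n-u_{n-1}|^2\,n^\alpha\ge\mathcal{A}^{\mathrm{disc}}_{\alpha,2}\sum_{n=1}^\infty|u_n|^2\,n^{\alpha-2}\qquad\text{for all }u\in H^1_0(\mathbb{N}).$$ $\mathcal{A}^{\mathrm{cont}}_{\alpha,2}$ denotes the sharp (largest) constant such that $\int_0^\infty|\varphi'(x)|^2 x^\alpha\,dx\ge\mathcal{A}^{\mathrm{cont}}_{\alpha,2}\int_0^\infty|\varphi(x)|^2 x^{\alpha-2}\,dx$ for all $\varphi\in C_0^\infty(0,\infty)$; its value (for $\alpha\neq1$) is known to be $\frac{(\alpha-1)^2}{4}$. *)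

(* Defs.v *)
From Stdlib Require Import Reals Lra.
From Coquelicot Require Import Coquelicot.
Open Scope R_scope.

(* The sharp constant in the inequality [A * P u <= E u] for all [u] satisfying
   [D u], as an extended real. When the supremum is finite it is itself
   admissible ([sharp_constant_attained]), hence the largest such [A]. *)
Definition sharp_constant {X : Type} (D : X -> Prop) (E P : X -> R) : Rbar :=
  Lub_Rbar (fun A : R => forall u : X, D u -> A * P u <= E u).

Lemma sharp_constant_attained {X : Type} (D : X -> Prop) (E P : X -> R) (A : R) :
  sharp_constant D E P = Finite A ->
  forall u : X, D u -> A * P u <= E u.
Proof.
unfold sharp_constant; intros HA u Du.
destruct (Lub_Rbar_correct (fun A : R => forall u : X, D u -> A * P u <= E u))
  as [Hub Hlub].
rewrite HA in Hub, Hlub.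
destruct (Rle_lt_dec (A * P u) (E u)) as [|Hlt]; trivial.
exfalso.
destruct (Rlt_le_dec 0 (P u)) as [HP|HP].
- assert (HAq : A <= E u / P u).
  { apply (Hlub (Finite (E u / P u))); intros B HB; simpl.
    apply Rle_div_r; auto. }
  apply Rle_div_r in HAq; lra.
- apply (Hlub m_infty); intros B HB; simpl.
  assert (HBA : B <= A) by exact (Hub B HB).
  specialize (HB u Du); nra.
Qed.

Definition H10_nat (u : nat -> R) : Prop :=
  u 0%nat = 0 /\ exists N : nat, forall n : nat, (N <= n)%nat -> u n = 0.

(* [Series] starts at index 0: the term of index [n] below is the one of index
   [n + 1] in the sums over n >= 1. *)
Definition disc_energy (alpha : R) (u : nat -> R) : R :=
  Series (fun n => Rabs (u (S n) - u n) ^ 2 * Rpower (INR (S n)) alpha).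

Definition disc_potential (alpha : R) (u : nat -> R) : R :=
  Series (fun n => Rabs (u (S n)) ^ 2 * Rpower (INR (S n)) (alpha - 2)).

Definition A_disc (alpha : R) : Rbar :=
  sharp_constant H10_nat (disc_energy alpha) (disc_potential alpha).

(* Functions on (0, +oo) with compact support are represented by their
   extension by 0 to the real line. *)
Definition Cc_infty_pos (phi : R -> R) : Prop :=
  (forall (n : nat) (x : R), ex_derive_n phi n x) /\
  exists a b : R, 0 < a /\ forall x : R, x < a \/ b < x -> phi x = 0.

Definition cont_energy (alpha : R) (phi : R -> R) : R :=
  RInt_gen (fun x => Rabs (Derive phi x) ^ 2 * Rpower x alpha)
    (at_right 0) (Rbar_locally p_infty).

Definition cont_potential (alpha : R) (phi : R -> R) : R :=
  RInt_gen (fun x => Rabs (phi x) ^ 2 * Rpower x (alpha - 2))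
    (at_right 0) (Rbar_locally p_infty).

Definition A_cont (alpha : R) : Rbar :=
  sharp_constant Cc_infty_pos (cont_energy alpha) (cont_potential alpha).

(* Main.v *)
(** The discrete constant is strictly below the continuous one. The indicator
    sequence of {1, ..., 5} has energy [1 + 6^alpha] and potential
    [1 + 2^(alpha-2) + ... + 5^(alpha-2)], and its Rayleigh quotient is already
    smaller than [(alpha-1)^2/4]: for [alpha <= -2] because
    [1 + 6^alpha < 9/4], for [alpha = -1] by a direct computation. On the
    continuous side Hardy's inequality holds with [k^2], [k = (1-alpha)/2],
    since [phi'^2 x^alpha - k^2 phi^2 x^(alpha-2)] is the sum of the derivative of
    [k phi^2 x^(alpha-1)] and of the square [(phi' - k phi / x)^2 x^alpha]. *)
Require Import Defs.
From Stdlib Require Import Reals.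
From Coquelicot Require Import Coquelicot.
From Stdlib Require Import Lra Lia FunctionalExtensionality.
Open Scope R_scope.

Lemma Series_finite_support (a : nat -> R) (N : nat) :
  (forall n : nat, (N < n)%nat -> a n = 0) -> Series a = sum_n a N.
Proof.
intros Ha.
apply is_series_unique.
apply (filterlim_ext_loc (fun _ => sum_n a N)); [|apply filterlim_const].
exists N; intros n Hn.
induction Hn as [|n Hn IH]; trivial.
rewrite sum_Sn, <- IH, Ha by lia.
symmetry; apply Rplus_0_r.
Qed.

(** For every lower endpoint below [c] and upper endpoint above [d], Chasles splits off two outer
    pieces where [f] vanishes, so the integral is constant along the filter. *)
Lemma RInt_gen_compact_support (f : R -> R) (c d : R) :
  0 < c -> ex_RInt f c d ->
  (forall x : R, x < c \/ d < x -> f x = 0) ->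
  RInt_gen f (at_right 0) (Rbar_locally p_infty) = RInt f c d.
Proof.
intros Hc Hf Hz.
apply is_RInt_gen_unique.
intros P HP.
apply (Filter_prod _ _ _ (fun x => x < c) (fun y => d < y)).
- exists (mkposreal c Hc); intros x Hx _.
  apply Rabs_lt_between' in Hx; simpl in Hx; lra.
- now exists d.
- intros x y Hx Hy; exists (RInt f c d); split; [|now apply locally_singleton].
  assert (Hl : is_RInt f x c 0).
  { apply (is_RInt_ext (fun _ => 0)).
    - rewrite Rmin_left, Rmax_right by lra; intros t Ht; symmetry; apply Hz; lra.
    - evar_last; [apply @is_RInt_const|apply Rmult_0_r]. }
  assert (Hr : is_RInt f d y 0).
  { apply (is_RInt_ext (fun _ => 0)).
    - rewrite Rmin_left, Rmax_right by lra; intros t Ht; symmetry; apply Hz; lra.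
    - evar_last; [apply @is_RInt_const|apply Rmult_0_r]. }
  evar_last.
  + apply (is_RInt_Chasles f x d y); [|exact Hr].
    apply (is_RInt_Chasles f x c d); [exact Hl|].
    now apply (RInt_correct f).
  + unfold plus; simpl; ring.
Qed.

Lemma is_derive_Rpower_l (p x : R) :
  0 < x -> is_derive (fun t => Rpower t p) x (p * Rpower x (p - 1)).
Proof.
intros Hx; apply is_derive_Reals, derivable_pt_lim_power; exact Hx.
Qed.

Lemma Derive_locally_zero (f : R -> R) (x : R) :
  locally x (fun t => f t = 0) -> Derive f x = 0.
Proof.
intros H.
rewrite (Derive_ext_loc f (fun _ => 0)) by exact H.
apply Derive_const.
Qed.

Lemma hardy_inequality (alpha : R) (phi : R -> R) :
  Cc_infty_pos phi ->
  ((1 - alpha) / 2) ^ 2 * cont_potential alpha phi <= cont_energy alpha phi.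
Proof.
intros [Hsm [a [b [Ha Hz]]]].
set (k := (1 - alpha) / 2).
(* Strict margins: [phi] is only known to vanish strictly outside the interval from [a] to [b], and
   [c > 0] keeps the powers of [x] smooth. The maximum covers the case [b < a]. *)
set (c := a / 2); set (d := Rmax a b + 1).
assert (Hc : 0 < c < a) by (unfold c; lra).
assert (Hd : a < d /\ b < d).
{ unfold d; split; [pose proof (Rmax_l a b)|pose proof (Rmax_r a b)]; lra. }
assert (Hphi : forall x, ex_derive phi x) by (intro x; exact (Hsm 1%nat x)).
assert (Hphi' : forall x, ex_derive (Derive phi) x)
  by (intro x; exact (Hsm 2%nat x)).
assert (Hz' : forall x, x < a \/ b < x -> Derive phi x = 0).
{ intros x [Hx|Hx]; apply Derive_locally_zero.
  - apply (filter_imp (fun t => t < a)); [intros; apply Hz; now left|].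
    now apply (open_lt a).
  - apply (filter_imp (fun t => b < t)); [intros; apply Hz; now right|].
    now apply (open_gt b). }
unfold cont_energy, cont_potential.
set (fE := fun x => Rabs (Derive phi x) ^ 2 * Rpower x alpha).
set (fP := fun x => Rabs (phi x) ^ 2 * Rpower x (alpha - 2)).
assert (EfE : fE = fun x => Derive phi x ^ 2 * Rpower x alpha).
{ apply functional_extensionality; intro x; unfold fE; now rewrite pow2_abs. }
assert (EfP : fP = fun x => phi x ^ 2 * Rpower x (alpha - 2)).
{ apply functional_extensionality; intro x; unfold fP; now rewrite pow2_abs. }
set (g := fun x => k * (phi x ^ 2 * Rpower x (alpha - 1))).
set (g' := fun x => k * (2 * phi x * Derive phi x * Rpower x (alpha - 1)
  + phi x ^ 2 * ((alpha - 1) * Rpower x (alpha - 1 - 1)))).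
assert (Hpow : forall p x, 0 < x -> ex_derive (fun t => Rpower t p) x).
{ intros p x Hx; eexists; now apply is_derive_Rpower_l. }
assert (HcE : forall x, 0 < x -> continuous fE x).
{ intros x Hx; rewrite EfE; apply @ex_derive_continuous.
  apply ex_derive_mult; [apply ex_derive_pow, Hphi'|now apply Hpow]. }
assert (HcP : forall x, 0 < x -> continuous fP x).
{ intros x Hx; rewrite EfP; apply @ex_derive_continuous.
  apply ex_derive_mult; [apply ex_derive_pow, Hphi|now apply Hpow]. }
assert (Hg : forall x, 0 < x -> is_derive g x (g' x)).
{ intros x Hx; unfold g, g'.
  apply is_derive_scal.
  evar_last.
  - apply @is_derive_mult; [apply is_derive_pow, Derive_correct, Hphi
      |now apply is_derive_Rpower_l|intros; apply Rmult_comm].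
  - unfold plus, mult; simpl; ring. }
assert (Hcg : forall x, 0 < x -> continuous g' x).
{ intros x Hx; apply @ex_derive_continuous; unfold g'.
  apply ex_derive_scal, @ex_derive_plus; apply ex_derive_mult.
  - apply ex_derive_mult; [apply ex_derive_scal, Hphi|apply Hphi'].
  - now apply Hpow.
  - apply ex_derive_pow, Hphi.
  - now apply ex_derive_scal, Hpow. }
assert (Hcd : forall x, Rmin c d <= x <= Rmax c d -> 0 < x).
{ intros x; rewrite Rmin_left, Rmax_right by lra; lra. }
assert (IE : ex_RInt fE c d).
{ apply @ex_RInt_continuous; auto. }
assert (IP : ex_RInt fP c d).
{ apply @ex_RInt_continuous; auto. }
rewrite (RInt_gen_compact_support fE c d), (RInt_gen_compact_support fP c d);
  try tauto.
2:{ intros x Hx; unfold fP; rewrite Hz by lra; rewrite Rabs_R0; ring. }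
2:{ intros x Hx; unfold fE; rewrite Hz' by lra; rewrite Rabs_R0; ring. }
(* The exact derivative integrates to 0, because [phi], hence [g], vanishes at [c] and [d]. *)
assert (Ig : is_RInt g' c d 0).
{ evar_last; [apply (is_RInt_derive g); auto|].
  unfold g, minus, plus, opp; simpl; rewrite (Hz c), (Hz d) by lra; ring. }
assert (Id : is_RInt (fun x => fE x - k ^ 2 * fP x) c d
               (RInt fE c d - k ^ 2 * RInt fP c d)).
{ apply @is_RInt_minus; [now apply (RInt_correct fE)|].
  apply (is_RInt_scal fP c d (k ^ 2)); now apply (RInt_correct fP). }
enough (0 <= RInt fE c d - k ^ 2 * RInt fP c d) by lra.
assert (Hcd' : c <= d) by lra.
apply (is_RInt_le _ _ _ _ _ _ Hcd' Ig Id).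
intros x Hx.
assert (Hx0 : 0 < x) by lra.
rewrite EfE, EfP; unfold g'.
replace (alpha - 1 - 1) with (alpha - 2) by ring.
(* Every power is brought to the common factor [x^(alpha-2)], which leaves a quadratic form in
   [phi' x] and [phi]. *)
replace (Rpower x (alpha - 1)) with (Rpower x (alpha - 2) * x).
2:{ rewrite <- (Rpower_1 x) at 2 by trivial; rewrite <- Rpower_plus; f_equal; ring. }
replace (Rpower x alpha) with (Rpower x (alpha - 2) * x ^ 2).
2:{ rewrite <- (Rpower_pow 2 x), <- Rpower_plus by trivial; f_equal; simpl; ring. }
apply Rminus_le_0.
replace (_ - _) with (Rpower x (alpha - 2) * (Derive phi x * x - k * phi x) ^ 2).
- apply Rmult_le_pos; [apply Rlt_le, exp_pos|apply pow2_ge_0].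
(* The choice of [k] enters here: [alpha - 1 = -2k] turns the coefficient of [phi^2] into
   [-k^2 + 2k^2 = k^2], completing the square. *)
- unfold k; field.
Qed.

(** Five is the least length that works at [alpha = -1]: the indicator of {1, ..., N} needs
    [1/(N+1) < 1/2^3 + ... + 1/N^3], which fails for [N <= 4]. *)
Definition indicator_1_to_5 (n : nat) : R :=
  match n with 1%nat | 2%nat | 3%nat | 4%nat | 5%nat => 1 | _ => 0 end.

Lemma indicator_1_to_5_H10 : H10_nat indicator_1_to_5.
Proof.
split; trivial.
exists 6%nat; intros n Hn.
do 6 (destruct n as [|n]; [lia|]); reflexivity.
Qed.

Lemma Rpower_1_l (p : R) : Rpower 1 p = 1.
Proof.
unfold Rpower; rewrite ln_1, Rmult_0_r; apply exp_0.
Qed.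

Lemma disc_energy_indicator (alpha : R) :
  disc_energy alpha indicator_1_to_5 = 1 + Rpower 6 alpha.
Proof.
unfold disc_energy.
(* Index 5 carries the downward jump from [u_5] to [u_6], of weight [6^alpha]; the upward jump sits
   at index 0. *)
rewrite (Series_finite_support _ 5).
- rewrite !sum_Sn, sum_O; unfold plus; simpl.
  rewrite Rpower_1_l, !Rminus_0_r, !Rminus_diag, !Rminus_0_l, Rabs_Ropp, Rabs_R1, Rabs_R0.
  replace (1 + 1 + 1 + 1 + 1 + 1) with 6 by ring; ring.
- intros n Hn.
  do 6 (destruct n as [|n]; [lia|]).
  simpl indicator_1_to_5; rewrite Rminus_diag, Rabs_R0; ring.
Qed.

Lemma disc_potential_indicator (alpha : R) :
  disc_potential alpha indicator_1_to_5 =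
  1 + Rpower 2 (alpha - 2) + Rpower 3 (alpha - 2) + Rpower 4 (alpha - 2)
    + Rpower 5 (alpha - 2).
Proof.
unfold disc_potential.
rewrite (Series_finite_support _ 4).
- rewrite !sum_Sn, sum_O; unfold plus; simpl.
  rewrite Rpower_1_l, Rabs_R1.
  replace (1 + 1 + 1 + 1 + 1) with 5 by ring.
  replace (1 + 1 + 1 + 1) with 4 by ring.
  replace (1 + 1 + 1) with 3 by ring.
  replace (1 + 1) with 2 by ring; ring.
- intros n Hn.
  do 5 (destruct n as [|n]; [lia|]).
  simpl indicator_1_to_5; rewrite Rabs_R0; ring.
Qed.

Lemma indicator_rayleigh_quotient_lt (alpha : Z) :
  (alpha < 0)%Z ->
  disc_energy (IZR alpha) indicator_1_to_5 <
  ((1 - IZR alpha) / 2) ^ 2 * disc_potential (IZR alpha) indicator_1_to_5.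
Proof.
intros Halpha.
rewrite disc_energy_indicator, disc_potential_indicator.
assert (H6 : Rpower 6 (-1) = / 6).
{ replace (-1) with (- (1)) by ring; rewrite Rpower_Ropp, Rpower_1; lra. }
assert (Hcases : alpha = (-1)%Z \/ (alpha <= -2)%Z) by lia.
destruct Hcases as [->|Hle].
- assert (Hcube : forall x, 0 < x -> Rpower x (-1 - 2) = / x ^ 3).
  { intros x Hx; rewrite <- Rpower_pow, <- Rpower_Ropp by trivial.
    f_equal; simpl; ring. }
  (* Here [k = 1], and the claim is [1 + 1/6 < 1 + 1/8 + 1/27 + 1/64 + 1/125]. *)
  rewrite H6, !Hcube by lra; lra.
- apply IZR_le in Hle.
  assert (H6a : Rpower 6 (IZR alpha) <= / 6).
  { rewrite <- H6; apply Rle_Rpower; lra. }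
  assert (Hpos : forall x, 0 < Rpower x (IZR alpha - 2)) by (intro; apply exp_pos).
  pose proof (Hpos 2); pose proof (Hpos 3); pose proof (Hpos 4); pose proof (Hpos 5).
  (* The energy is at most 7/6 and the potential exceeds 1, so [k^2 >= 9/4] suffices. *)
  assert (Hk : 9 / 4 <= ((1 - IZR alpha) / 2) ^ 2) by nra.
  nra.
Qed.

Theorem proposition4p10 (alpha : Z) (halpha : (alpha < 0)%Z) :
  A_disc (IZR alpha) <> A_cont (IZR alpha).
Proof.
intros Heq.
assert (Hcont : Rbar_le (((1 - IZR alpha) / 2) ^ 2) (A_cont (IZR alpha))).
{ apply Lub_Rbar_correct; intros phi; apply hardy_inequality. }
rewrite <- Heq in Hcont.
pose proof (indicator_rayleigh_quotient_lt alpha halpha) as Hlt.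
assert (HP : 0 < disc_potential (IZR alpha) indicator_1_to_5).
{ rewrite disc_potential_indicator.
  repeat apply Rplus_lt_0_compat; try apply exp_pos; lra. }
assert (Hdisc : Rbar_le (A_disc (IZR alpha))
  (disc_energy (IZR alpha) indicator_1_to_5
     / disc_potential (IZR alpha) indicator_1_to_5)).
{ apply Lub_Rbar_correct; intros A HA; simpl.
  apply Rle_div_r; [exact HP|apply HA, indicator_1_to_5_H10]. }
(* If the constants agreed, [k^2] would be at most the Rayleigh quotient of the indicator, which is
   smaller than [k^2]. *)
pose proof (Rbar_le_trans _ _ _ Hcont Hdisc) as Hle; simpl Rbar_le in Hle.
apply Rle_div_r in Hle; [lra|exact HP].
Qed.
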